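(* Let $G$ be an acyclic ADT network with a source $S$ and destinations $T_1,\dots,T_N$. Let $\mathcal C=\mathcal C_d\cup\mathcal C_m$, where: - $\mathcal C_d=\{(S,T_i,\mathcal X(S,T_i)) : i\in[1,K]\}$ with $\mathcal X(S,T_i)\cap\mathcal X(S,T_j)=\emptyset$ for $i\ne j$ in $[1,K]$ (a disjoint multicast); - $\mathcal C_m=\{(S,T_i,\mathcal X(S)) : i\in[K+1,N]\}$ (a multicast of all source processes). Then $(G,\mathcal C)$ is solvable if and only if both of the following hold: - $\mathrm{mincut}(S,\mathcal T')\ge\sum_{T_i\in\mathcal T'}|\mathcal X(S,T_i)|$ for every $\mathcal T'\subseteq\{T_1,\dots,T_K\}$; - $\mathrm{mincut}(S,T_j)\ge|\mathcal X(S)|$ for every $j\in[K+1,N]$.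
   Context: ADT network model. $G=(\mathcal V,\mathcal E)$ is a directed acyclic network of supernodes, each with input ports $I(V)$ and output ports $O(V)$. Edges go from output ports to input ports of other supernodes. Linear coding over a finite field $\mathbb F_q$: - An output port $e\in O(V)$ carries $Y(e)=\sum_{e'\in I(V)}\beta_{(e',e)}Y(e')$. At $S$, the term $\sum_k\alpha_{(k,e)}X(S,k)$ is added, where $\mathcal X(S)$ are the independent source processes. - An output port sends the same symbol on all of its outgoing edges. - An input port $e'$ receives $Y(e')=\sum_{(e,e')\in\mathcal E}Y(e)$, the sum taken over $\mathbb F_q$. - A destination $T$ outputs $Z(T,k)=\sum_{e'\in I(T)}\epsilon_{(e',(T,k))}Y(e')$. A connection $(S,T,\mathcal X')$ is established if $T$'s outputs equal $\mathcal X'$. $(G,\mathcal C)$ is solvable if a single coefficient choice establishes all connections. Following the paper's convention, the field size $q$ may be chosen as large as needed. For a set $\mathcal T'$ of supernodes, $\mathrm{mincut}(S,\mathcal T')=\min_\Omega\mathrm{rank}(G_\Omega)$, with the minimum over partitions $\Omega\cup\Omega^c$ of the supernodes with $S\in\Omega$ and $\mathcal T'\subseteq\Omega^c$. $G_\Omega$ is the $0$-$1$ incidence matrix of the edges from output ports of supernodes in $\Omega$ to input ports of supernodes in $\Omega^c$. *)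

(* Defs.v *)
From mathcomp Require Import all_boot all_order all_algebra.
Set Implicit Arguments. Unset Strict Implicit. Unset Printing Implicit Defensive.
Import GRing.Theory.
Local Open Scope ring_scope.

(* ADT network: supernodes V, ports P; own e = supernode of port e;
   inp e = true iff e is an input port; E = edges (output port -> input port). *)

Definition wf_edges (V P : finType) (own : P -> V) (inp : pred P) (E : rel P) :=
  forall e e', E e e' -> [&& ~~ inp e, inp e' & own e != own e'].

Definition sedge (V P : finType) (own : P -> V) (E : rel P) : rel V :=
  fun u v => [exists e, exists e', [&& E e e', own e == u & own e' == v]].

Definition acyclic_net (V P : finType) (own : P -> V) (E : rel P) :=
  forall u v, sedge own E u v -> ~~ connect (sedge own E) v u.

(* Y : P -> F are the symbols carried by the ports, for source symbols x. *)
Definition consistent (F : fieldType) (V P : finType) (own : P -> V)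
    (inp : pred P) (E : rel P) (S : V) (r : nat)
    (alpha : 'I_r -> P -> F) (beta : P -> P -> F)
    (x : 'I_r -> F) (Y : P -> F) : Prop :=
  forall e, Y e =
    if inp e then \sum_(e0 | E e0 e) Y e0
    else \sum_(e' | inp e' && (own e' == own e)) beta e' e * Y e'
         + (if own e == S then \sum_(k < r) alpha k e * x k else 0).

Definition dest_out (F : fieldType) (V P : finType) (own : P -> V)
    (inp : pred P) (r N : nat) (T : 'I_N -> V)
    (eps : 'I_N -> 'I_r -> P -> F) (Y : P -> F) (i : 'I_N) (k : 'I_r) : F :=
  \sum_(e' | inp e' && (own e' == T i)) eps i k e' * Y e'.

Definition solvable_over (F : fieldType) (V P : finType) (own : P -> V)
    (inp : pred P) (E : rel P) (S : V) (r N : nat) (T : 'I_N -> V)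
    (dem : 'I_N -> {set 'I_r}) : Prop :=
  exists (alpha : 'I_r -> P -> F) (beta : P -> P -> F)
         (eps : 'I_N -> 'I_r -> P -> F),
    forall (x : 'I_r -> F) (Y : P -> F),
      consistent own inp E S alpha beta x Y ->
      forall i k, k \in dem i -> dest_out own inp T eps Y i k = x k.

Definition GOm (p : nat) (V P : finType) (own : P -> V) (inp : pred P)
    (E : rel P) (Om : {set V}) : 'M['F_p]_#|P| :=
  \matrix_(i < #|P|, j < #|P|)
    ([&& own (enum_val i) \in Om, ~~ inp (enum_val i),
         own (enum_val j) \notin Om, inp (enum_val j)
       & E (enum_val i) (enum_val j)] : nat)%:R.

Definition mincut (p : nat) (V P : finType) (own : P -> V) (inp : pred P)
    (E : rel P) (S : V) (T' : {set V}) : nat :=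
  \big[minn/#|P|]_(Om : {set V} | (S \in Om) && [disjoint T' & Om])
     \rank (GOm p own inp E Om).

(* Main.v *)
Require Import Defs.
From mathcomp Require Import all_boot all_order all_algebra all_field.
Set Implicit Arguments. Unset Strict Implicit. Unset Printing Implicit Defensive.
Import GRing.Theory.

(* Write the port equations together with r linear outputs, the k-th one read
   at a prescribed supernode, as one square matrix M in the unknowns (port
   symbols, source symbols).  The coding coefficients fill one block of M per
   supernode.  For idempotents L and R, the largest rank of A + L X R is
   min (rk L + rk ((1 - L) A), rk R + rk (A (1 - R))); applied supernode by
   supernode this gives the generic rank of M as a minimum over sets Om of
   supernodes, and the term of Om is |P| + r as soon as rank G_Om is at least
   the number of outputs read outside Om.  So the cut conditions say that M is
   generically invertible, simultaneously for the outputs of the disjoint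
   multicast and for those of each full destination; the determinants are
   polynomials along lines in the space of coefficients, hence a large field
   has a common good choice.  As the port equations are solvable by acyclicity,
   invertibility of M is that of the r x r transfer matrix; precoding by the
   inverse of the one of the disjoint multicast separates the demands, and the
   full destinations invert theirs.
   Conversely, a source vector supported on the demands read outside Om whose
   symbols cancel across the cut silences every port outside Om, so it is 0. *)

(** * Rank after filling a single block *)

Section BlockUpdate.
Local Open Scope ring_scope.
Variable F : fieldType.

(** Some row [w] kills [A] but not [u]; normalised to [w *m u = 1], it gives [w *m B = v]. So the
    row space of [B] contains [v], hence that of [A], strictly. *)
Lemma mxrank_add_mul m n (A : 'M[F]_(m, n)) (u : 'cV_m) (v : 'rV_n) :
  ~~ (u^T <= A^T)%MS -> ~~ (v <= A)%MS -> (\rank A < \rank (A + u *m v)%R)%N.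
Proof.
set B := (A + u *m v)%R; move=> uA vA; have [w wA wu] : exists2 w : 'rV_m, w *m A = 0 & w *m u = 1%:M.
  have /rV0Pn[j cj] : u^T *m cokermx A^T != 0 by rewrite -submxE.
  move: (cokermx _) (mulmx_coker A^T) cj => C AC cj.
  exists (((u^T *m C) 0 j)^-1 *: (col j C)^T); apply: trmx_inj.
    by rewrite trmx0 trmx_mul linearZ /= trmxK -scalemxAr colE mulmxA AC
       mul0mx scaler0.
  rewrite trmx_mul linearZ /= trmxK -scalemxAr colE mulmxA -colE.
  by apply/matrixP=> a b; rewrite !ord1 mxE [col _ _ _ _]mxE mulVf // trmx1 mxE.
have vB : (v <= B)%MS.
  by apply/submxP; exists w; rewrite mulmxDr wA add0r mulmxA wu mul1mx.
have AB : (A <= B)%MS.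
  rewrite -[A](addrK (u *m v)) addmx_sub ?submx_refl //.
  by rewrite eqmx_opp (submx_trans (submxMl _ _)).
have : (A < B)%MS.
  by rewrite ltmxE AB /=; apply: contra vA; apply: submx_trans.
exact: rank_ltmx.
Qed.

Lemma mxrank_idem_sub m n (A : 'M[F]_(m, n)) (R : 'M_n) :
  R *m R = R -> (R <= A)%MS -> (\rank R + \rank (A *m (1%:M - R)%R) <= \rank A)%N.
Proof.
move=> RR RA; rewrite -(mxrank_mul_ker A (1%:M - R)) addnC leq_add2l.
by rewrite mxrankS // sub_capmx RA; apply/sub_kermxP; rewrite mulmxBr mulmx1 RR subrr.
Qed.

(* As long as the rank is below k, some column of L lies outside the column
   space and some row of R outside the row space; adding their product raises
   the rank. *)
Lemma mxrank_block_update m n (L : 'M[F]_m) (R : 'M_n) (A : 'M_(m, n)) k :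
    L *m L = L -> R *m R = R ->
    (k <= \rank L + \rank ((1%:M - L)%R *m A))%N ->
    (k <= \rank R + \rank (A *m (1%:M - R)%R))%N ->
  exists X : 'M_(m, n), (k <= \rank (A + L *m X *m R)%R)%N.
Proof.
move=> LL RR kL kR.
suff step d : (k - \rank A <= d)%N ->
    exists X : 'M_(m, n), (k <= \rank (A + L *m X *m R)%R)%N.
  exact: step (leqnn _).
elim: d => [|d IHd] in A kL kR *.
  rewrite leqn0 subn_eq0 => kA.
  by exists 0; rewrite mulmx0 mul0mx addr0.
move=> kd; have [kA|Ak] := leqP k (\rank A).
  by exists 0; rewrite mulmx0 mul0mx addr0.
have nRA : ~~ (R <= A)%MS.
  by apply: contraL Ak => /(mxrank_idem_sub RR) /(leq_trans kR); rewrite -leqNgt.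
have nLA : ~~ (L^T <= A^T)%MS.
  apply: contraL Ak => /mxrank_idem_sub; rewrite -trmx_mul LL => /(_ erefl).
  rewrite -[X in _ - X]trmxK -[1%:M]trmx1 !trmxK -linearB -trmx_mul !mxrank_tr.
  by move/(leq_trans kL); rewrite -leqNgt.
have [i iR] : exists i, ~~ (row i R <= A)%MS by apply/row_subPn.
have [j jL] : exists j, ~~ (row j L^T <= A^T)%MS by apply/row_subPn.
have := mxrank_add_mul (u := col j L) (v := row i R).
move=> /(_ A); rewrite tr_col => /(_ jL iR).
have -> : col j L *m row i R = L *m delta_mx j i *m R.
  by rewrite colE rowE -!mulmxA (mulmxA (delta_mx j _)) mul_delta_mx !mulmxA.
move=> rkA; set A' := A + _ in rkA.
(* Adding a matrix of the form [L *m Y *m R] changes neither [(1 - L) A] nor [A (1 - R)], so both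
   bounds carry over to [A']. *)
have [||| X kX] := IHd A'.
- by rewrite mulmxDr !mulmxA (mulmxBl _ _ L) mul1mx LL subrr !mul0mx addr0.
- by rewrite mulmxDl -!mulmxA (mulmxBr R) mulmx1 RR subrr !mulmx0 addr0.
- by rewrite -ltnS (leq_trans (ltn_sub2l Ak rkA)).
exists (delta_mx j i + X); rewrite mulmxDr mulmxDl addrA; exact: kX.
Qed.

End BlockUpdate.

(** * Generic conditions along lines over a large field *)

Section Generic.
Local Open Scope ring_scope.
Variable F : finFieldType.

(** One good point on a line leaves at most [d] bad parameters. This stands for the non-vanishing of
    a polynomial of degree at most [d], without multivariate polynomials. *)
Definition generic (W : lmodType F) d (C : W -> Prop) :=
  forall b c t0, C (b + t0 *: c) ->
  exists2 B : {set F}, (#|B| <= d)%N & forall t, t \notin B -> C (b + t *: c).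

Lemma size_det_line k (A B : 'M[F]_k) :
  (size (\det (map_mx polyC A + 'X *: map_mx polyC B)) <= k.+1)%N.
Proof.
apply: leq_trans (size_sum _ _ _) _; apply/bigmax_leqP => s _.
rewrite mulr_sign (fun_if (fun q : {poly F} => size q)) size_polyN if_same.
apply: leq_trans (size_poly_prod_leq _ _) _.
rewrite leq_subLR cardE size_enum_ord addnS ltnS addnn -muln2.
apply: (@leq_trans (\sum_(i < k) 2)); last by rewrite sum_nat_const card_ord.
rewrite leq_sum // => i _; rewrite !mxE (leq_trans (size_polyD _ _)) //.
rewrite geq_max size_polyC (leq_trans (leq_b1 _)) // mulrC mul_polyC.
by rewrite (leq_trans (size_scale_leq _ _)) // size_polyX.
Qed.

(** Compress the matrix to the k x k identity at [t0]. Along the line, the determinant of the same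
    compression is a polynomial of degree at most [k], non-zero at [t0]; off its roots the rank is
    at least [k]. *)
Lemma generic_mxrank m n k : generic k (fun A : 'M[F]_(m, n) => k <= \rank A)%N.
Proof.
move=> A B t0 kA.
have [P [R PR]] : exists P : 'M_(k, m), exists R : 'M_(n, k),
    P *m (A + t0 *: B) *m R = 1%:M.
  set M := A + _ in kA *; exists (pid_mx k *m invmx (col_ebase M)).
  exists (invmx (row_ebase M) *m pid_mx k).
  rewrite -{2}(mulmx_ebase M) !mulmxA mulmxKV ?col_ebase_unit // mulmxK ?row_ebase_unit //.
  by rewrite !mul_pid_mx (minn_idPl kA) (minn_idPr (leq_trans kA (rank_leq_row _)))
       minnn (minn_idPr (leq_trans kA (rank_leq_col _))) pid_mx_1.
pose q := \det (map_mx polyC (P *m A *m R) + 'X *: map_mx polyC (P *m B *m R)).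
have qE t : q.[t] = \det (P *m (A + t *: B) *m R).
  rewrite -horner_evalE -det_map_mx; congr (\det _); apply/matrixP=> i j.
  by rewrite mulmxDr mulmxDl -scalemxAr -scalemxAl !mxE /= horner_evalE !hornerE.
have q0 : q != 0.
  by apply: contraTneq (oner_neq0 F) => qz; rewrite negbK -(det1 F k) -PR -qE qz horner0.
exists [set t | root q t] => [|t]; last first.
  rewrite inE rootE qE -unitfE -/(_ \in unitmx) => /mxrank_unit rk.
  by rewrite -rk (leq_trans (mxrankM_maxl _ _)) ?mxrankM_maxr.
rewrite -ltnS cardE (leq_trans _ (size_det_line (P *m A *m R) (P *m B *m R))) //.
apply: max_poly_roots; rewrite ?enum_uniq //.
by apply/allP=> t; rewrite mem_enum inE.
Qed.

(** Conditions are added one at a time: join a point good for the earlier ones to a point good for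
    the new one. Each condition excludes at most [d] parameters of that line, and the field has more
    than [#|J| * d]. *)
Lemma generic_exists (W : lmodType F) (J : finType) d (Sup : W -> Prop)
    (C : J -> W -> Prop) :
    Sup 0 -> (forall b c t, Sup b -> Sup c -> Sup (b + t *: (c - b))) ->
    (forall j, generic d (C j)) -> (#|J| * d < #|F|)%N ->
    (forall j, exists2 b, Sup b & C j b) ->
  exists2 b, Sup b & forall j, C j b.
Proof.
move=> S0 Sline genC dF exC.
suff [b Sb Cb] : exists2 b, Sup b & forall j, j \in enum J -> C j b.
  by exists b => // j; apply: Cb; rewrite mem_enum.
rewrite cardE in dF; elim: (enum J) dF => [|i s IHs] dF; first by exists 0.
have [|b Sb Cb] := IHs; first by apply: leq_ltn_trans dF; rewrite leq_mul2r leqnSn orbT.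
have [c Sc Cc] := exC i; pose pt t := b + t *: (c - b).
have gens : exists2 B : {set F}, (#|B| <= size s * d)%N &
    forall t, t \notin B -> forall j, j \in s -> C j (pt t).
  elim: s Cb {IHs dF} => [|j s IHs] Cb; first by exists set0; rewrite ?cards0.
  have [|B Bd BC] := IHs; first by move=> l ls; apply: Cb; rewrite inE ls orbT.
  have [|B' Bd' BC'] := genC j b (c - b) 0.
    by rewrite scale0r addr0; apply: Cb; rewrite mem_head.
  exists (B' :|: B); first by rewrite (leq_trans (leq_card_setU _ _)) // mulSn leq_add.
  by move=> t; rewrite !inE => /norP[tB' tB] l /predU1P[->|ls]; [exact: BC'|exact: BC].
have [B Bd BC] := gens.
have [|B' Bd' BC'] := genC i b (c - b) 1; first by rewrite scale1r addrC subrK.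
have [t] : exists t, t \notin B' :|: B.
  apply/existsP; apply: contraTT dF; rewrite negb_exists -leqNgt => /forallP all_bad.
  apply: leq_trans (_ : #|B' :|: B| <= _)%N.
    by rewrite subset_leq_card //; apply/subsetP=> t _; rewrite -[_ \in _]negbK.
  by rewrite (leq_trans (leq_card_setU _ _)) // mulSn leq_add.
rewrite !inE => /norP[tB' tB]; exists (pt t); first exact: Sline.
by move=> j /predU1P[->|js]; [exact: BC'|exact: BC].
Qed.

End Generic.

(** * Coordinate projections *)

Section DiagonalProjection.
Local Open Scope ring_scope.
Variable F : fieldType.

Definition diag_proj m (A : pred 'I_m) : 'M[F]_m := diag_mx (\row_i (A i)%:R).

Lemma mul_diag_projE m n (A : pred 'I_m) (M : 'M_(m, n)) i j :
  (diag_proj A *m M) i j = (A i)%:R * M i j.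
Proof. by rewrite mul_diag_mx !mxE. Qed.

Lemma mul_mx_diag_projE m n (A : pred 'I_n) (M : 'M_(m, n)) i j :
  (M *m diag_proj A) i j = M i j * (A j)%:R.
Proof. by rewrite mul_mx_diag !mxE. Qed.

Lemma eq_diag_proj m (A B : pred 'I_m) : A =1 B -> diag_proj A = diag_proj B.
Proof. by move=> AB; congr diag_mx; apply/rowP=> i; rewrite !mxE AB. Qed.

Lemma mul_diag_proj m (A B : pred 'I_m) :
  diag_proj A *m diag_proj B = diag_proj (predI A B).
Proof. by rewrite mulmx_diag; congr diag_mx; apply/rowP=> i; rewrite !mxE -natrM mulnb. Qed.

Lemma diag_proj_idem m (A : pred 'I_m) : diag_proj A *m diag_proj A = diag_proj A.
Proof. by rewrite mul_diag_proj; apply: eq_diag_proj => i /=; rewrite andbb. Qed.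

Lemma diag_projC m (A : pred 'I_m) : diag_proj (predC A) = 1%:M - diag_proj A.
Proof.
apply/matrixP=> i j; rewrite !mxE -mulrnBl; congr (_ *+ _).
by rewrite /=; case: (A i); rewrite ?subr0 ?subrr.
Qed.

Lemma mxrank_diag_proj m (A : pred 'I_m) : (#|A| <= \rank (diag_proj A))%N.
Proof.
pose f (i : 'I_#|A|) : 'I_m := enum_val i.
have def1 : rowsub f 1%:M *m diag_proj A *m colsub f 1%:M = 1%:M.
  rewrite mul_rowsub_mx mul1mx mulmx_colsub mulmx1; apply/matrixP=> i j.
  rewrite !mxE (inj_eq enum_val_inj); congr (_ *+ _).
  by have := enum_valP i; rewrite unfold_in => ->.
by rewrite -[leqLHS](mxrank1 F) -def1 (leq_trans (mxrankM_maxl _ _)) ?mxrankM_maxr.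
Qed.

End DiagonalProjection.

(** * Generic rank of a matrix with free diagonal blocks *)

Section BlockRank.
Local Open Scope ring_scope.
Variables (F : finFieldType) (V : finType) (m n : nat).
(* None marks a row or column outside every block. *)
Variables (rho : 'I_m -> option V) (gam : 'I_n -> option V).

Definition coloured k (col : 'I_k -> option V) (U : {set V}) : pred 'I_k :=
  fun i => oapp (fun v => v \in U) false (col i).

Definition block_supported (U : {set V}) (X : 'M[F]_(m, n)) :=
  forall i j, X i j != 0 -> coloured rho U i /\ rho i = gam j.

Lemma block_supported0 U : block_supported U 0.
Proof. by move=> i j; rewrite mxE eqxx. Qed.

Lemma block_supported_line U X Y t :
  block_supported U X -> block_supported U Y -> block_supported U (X + t *: (Y - X)).
Proof.
move=> SX SY i j; rewrite !mxE; have [X0|/SX //] := eqVneq (X i j) 0.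
have [Y0|/SY //] := eqVneq (Y i j) 0.
by rewrite X0 Y0 subrr mulr0 addr0 eqxx.
Qed.

Lemma block_supported_sub (U U' : {set V}) X :
  U' \subset U -> block_supported U' X -> block_supported U X.
Proof.
move=> /subsetP sU SX i j /SX[]; rewrite /coloured.
by case: (rho i) => //= v vU <-; split=> //; apply: sU.
Qed.

(** An upper bound for the rank of [Q + X] over all fillings [X] of the blocks in [U]: once the rows
    coloured in [Om] and the columns coloured in [U :\: Om] are deleted, nothing of [X] survives. *)
Definition cut_rank (U Om : {set V}) (Q : 'M[F]_(m, n)) : nat :=
  (#|coloured rho Om| + #|coloured gam (U :\: Om)|
   + \rank (diag_proj F (predC (coloured rho Om)) *m Q
            *m diag_proj F (predC (coloured gam (U :\: Om)))))%N.

Lemma card_coloured_setU1 k (col : 'I_k -> option V) v (U : {set V}) :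
  v \notin U -> #|coloured col (v |: U)| = (#|coloured col [set v]| + #|coloured col U|)%N.
Proof.
move=> vU; rewrite -cardUI [X in (_ + X)%N]eq_card0 ?addn0 => [|i].
  apply: eq_card => i; rewrite !inE unfold_in /coloured -!topredE /= /coloured.
  by case: (col i) => //= w; rewrite !inE.
rewrite !inE -!topredE /= /coloured; case: (col i) => //= w; rewrite !inE.
by case: eqP => // ->; rewrite (negPf vU).
Qed.

Lemma diag_proj_coloured_setU1 k (col : 'I_k -> option V) v (U : {set V}) :
  diag_proj F (predC (coloured col (v |: U))) =
  diag_proj F (predC (coloured col U)) *m diag_proj F (predC (coloured col [set v])).
Proof.
rewrite mul_diag_proj; apply: eq_diag_proj => i /=; rewrite /coloured.
by case: (col i) => //= w; rewrite !inE negb_or andbC.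
Qed.

Lemma generic_mxrank_add k d (Q : 'M[F]_(m, n)) :
  (k <= d)%N -> generic d (fun X => k <= \rank (Q + X)%R)%N.
Proof.
move=> kd b c t0; rewrite addrA => /generic_mxrank[B Bk BC].
by exists B => [|t /BC]; [exact: leq_trans kd | rewrite addrA].
Qed.

(* Each block needs two rank bounds on the filling of the other blocks; both
   hold at most points of the line joining a filling for each of them. *)
Lemma block_rank (U : {set V}) (Q : 'M[F]_(m, n)) k :
    (2 * k < #|F|)%N ->
    (forall Om : {set V}, Om \subset U -> (k <= cut_rank U Om Q)%N) ->
  exists2 X, block_supported U X & (k <= \rank (Q + X)%R)%N.
Proof.
elim: {U}#|U| {-2}U (leqnn #|U|) Q k => [|d IHd] U Ud Q k kF kcut.
  move: Ud kcut; rewrite leqn0 cards_eq0 => /eqP-> kcut.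
  exists 0; first exact: block_supported0.
  have := kcut set0 (sub0set _); rewrite /cut_rank setD0.
  have col0 l (col : 'I_l -> option V) : coloured col set0 =1 pred0.
    by move=> i; rewrite /coloured; case: (col i) => //= v; rewrite inE.
  rewrite !eq_card0 ?add0n ?addr0; try by move=> i; apply: col0.
  move/leq_trans; apply; rewrite (leq_trans (mxrankM_maxl _ _)) //.
  exact: mxrankM_maxr.
have [U0|[v vU]] := set_0Vmem U; first by apply: IHd => //; rewrite U0 cards0.
pose U' := U :\ v.
have U'd : (#|U'| <= d)%N by rewrite -ltnS (leq_trans _ Ud) // (cardsD1 v U) vU.
pose L := diag_proj F (coloured rho [set v]); pose R := diag_proj F (coloured gam [set v]).
pose a := #|coloured rho [set v]|; pose c := #|coloured gam [set v]|.
(* Deleting the rows of colour [v] leaves a problem over [U'], whose cut at [Om] is the given one at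
   [v |: Om]. Deleting the columns, as in [exR] below, keeps [Om] and so puts [v] on the other
   side. *)
have exL : exists2 X, block_supported U' X &
    (k - a <= \rank ((1%:M - L) *m Q + X)%R)%N.
  apply: IHd => // [|Om sOm].
    by apply: leq_ltn_trans kF; rewrite leq_mul2l leq_subr.
  have vOm : v \notin Om by apply/negP=> /(subsetP sOm); rewrite !inE eqxx.
  rewrite leq_subLR (leq_trans (kcut (v |: Om) _)) ?subUset ?sub1set ?vU //=.
    by rewrite (subset_trans sOm) ?subD1set.
  rewrite /cut_rank card_coloured_setU1 // diag_proj_coloured_setU1 -diag_projC.
  by rewrite -!addnA !mulmxA /U' setDDl.
have exR : exists2 X, block_supported U' X &
    (k - c <= \rank (Q *m (1%:M - R) + X)%R)%N.
  apply: IHd => // [|Om sOm].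
    by apply: leq_ltn_trans kF; rewrite leq_mul2l leq_subr.
  have vOm : v \notin Om by apply/negP=> /(subsetP sOm); rewrite !inE eqxx.
  rewrite leq_subLR (leq_trans (kcut Om _)) ?(subset_trans sOm) ?subD1set //.
  have UOm : U :\: Om = v |: (U' :\: Om).
    by apply/setP=> w; rewrite !inE; case: eqP => // ->; rewrite vOm vU.
  rewrite /cut_rank UOm card_coloured_setU1 ?inE ?eqxx ?andbF //.
  rewrite diag_proj_coloured_setU1 [X in _ *m X]diag_mxC -diag_projC.
  by rewrite addnCA -!addnA !mulmxA addnCA.
have [X SX kX] : exists2 X, block_supported U' X &
    forall b : bool, (if b then k - a <= \rank ((1%:M - L) *m Q + X)%R
                      else k - c <= \rank (Q *m (1%:M - R) + X)%R)%N.
  apply: (generic_exists (d := k)).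
  - exact: block_supported0.
  - by move=> b1 b2 t; apply: block_supported_line.
  - by case; apply: generic_mxrank_add; rewrite leq_subr.
  - by rewrite card_bool.
  - by case.
have vU' i j : X i j != 0 -> (rho i != Some v) && (gam j != Some v).
  move=> /SX[]; rewrite /coloured; case: (rho i) => //= w wU' <-.
  by rewrite andbb; apply: contraTneq wU' => -[->]; rewrite !inE eqxx.
have inv l (col : 'I_l -> option V) i : coloured col [set v] i = (col i == Some v).
  by rewrite /coloured; case: (col i) => //= w; rewrite inE.
have LX : (1%:M - L) *m X = X.
  rewrite -diag_projC; apply/matrixP=> i j; rewrite mul_diag_projE /= inv.
  by have [->|/vU'/andP[-> _]] := eqVneq (X i j) 0; rewrite ?mulr0 ?mul1r.
have XR : X *m (1%:M - R) = X.
  rewrite -diag_projC; apply/matrixP=> i j; rewrite mul_mx_diag_projE /= inv.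
  by have [->|/vU'/andP[_ ->]] := eqVneq (X i j) 0; rewrite ?mul0r ?mulr1.
have [||||Y kY] := @mxrank_block_update _ _ _ L R (Q + X) k.
- exact: diag_proj_idem.
- exact: diag_proj_idem.
- rewrite mulmxDr LX -leq_subLR (leq_trans _ (kX true)) // leq_sub2l //.
  exact: mxrank_diag_proj.
- rewrite mulmxDl XR -leq_subLR (leq_trans _ (kX false)) // leq_sub2l //.
  exact: mxrank_diag_proj.
exists (X + L *m Y *m R); last by rewrite addrA.
move=> i j; rewrite mxE mul_mx_diag_projE mul_diag_projE !inv.
have [->|/(block_supported_sub (subD1set _ _) SX) //] := eqVneq (X i j) 0.
rewrite /coloured; case: (rho i =P _) => [->|_]; last by rewrite !mul0r addr0 eqxx.
by case: (gam j =P _) => [->|_]; rewrite ?mulr0 ?addr0 ?eqxx //= vU.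
Qed.

End BlockRank.

(** * Rank of a projection minus a nilpotent matrix *)

Section CutRank.
Local Open Scope ring_scope.

(** The unipotent factors [1 + N D] and [1 + D N D'] clear the mixed terms and turn [D - N] into
    [D - D' N D'], whose two parts live on complementary summands. *)
Lemma mxrank_idem_nilpotent (F : fieldType) n (D N : 'M[F]_n) :
    D *m D = D -> N *m N = 0 -> N *m D *m N = 0 ->
  (\rank D + \rank ((1%:M - D)%R *m N *m (1%:M - D)%R) <= \rank (D - N)%R)%N.
Proof.
move=> DD NN NDN; set D' := (1%:M - D)%R; set W := (D - D' *m N *m D')%R.
have DD' : D *m D' = 0 by rewrite mulmxBr mulmx1 DD subrr.
have D'D : D' *m D = 0 by rewrite mulmxBl mul1mx DD subrr.
have D'D' : D' *m D' = D' by rewrite {1}/D' mulmxBl mul1mx DD' subr0.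
have WE : (1%:M + N *m D) *m (D - N) *m (1%:M + D *m N *m D') = W.
  have -> : (1%:M + N *m D) *m (D - N) = D - N *m D'.
    rewrite mulmxDl mul1mx mulmxBr NDN subr0 -mulmxA DD /D' mulmxBr mulmx1.
    by rewrite opprB [in RHS]addrA addrAC.
  rewrite mulmxDr mulmx1 mulmxBl !mulmxA DD -(mulmxA N D' D) D'D mulmx0 !mul0mx subr0.
  by rewrite /W {2}/D' !mulmxBl mul1mx opprB addrA addrAC.
have : (\rank W <= \rank (D - N)%R)%N.
  by rewrite -WE (leq_trans (mxrankM_maxl _ _)) ?mxrankM_maxr.
apply: leq_trans; rewrite -(mxrank_mul_ker W D') addnC leq_add //.
  have -> : W *m D' = - (D' *m N *m D').
    by rewrite /W (mulmxBl D) DD' sub0r -(mulmxA (D' *m N)) D'D'.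
  by rewrite mxrank_opp.
rewrite mxrankS // sub_capmx; apply/andP; split; last exact/sub_kermxP.
by apply/submxP; exists D; rewrite (mulmxBr D D) DD !mulmxA DD' !mul0mx subr0.
Qed.

Lemma card_ord_add m n (A : pred 'I_(m + n)) :
  #|A| = (#|[pred i | A (lshift n i)]| + #|[pred j | A (rshift m j)]|)%N.
Proof.
rewrite -!sum1_card big_mkcond big_split_ord /= [in RHS]big_mkcond /=.
by congr (_ + _)%N; rewrite [RHS]big_mkcond.
Qed.

Lemma diag_proj_add (F : fieldType) m n (A : pred 'I_(m + n)) :
  diag_proj F A = block_mx (diag_proj F [pred i | A (lshift n i)]) 0
                           0 (diag_proj F [pred j | A (rshift m j)]).
Proof.
rewrite /diag_proj -diag_mx_row; congr diag_mx; apply/rowP=> i.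
by rewrite !mxE; case: splitP => j ij; rewrite mxE; congr (A _)%:R; apply: val_inj.
Qed.

End CutRank.

(** * The cut terms of the network matrix *)

Section Network.
Local Open Scope ring_scope.
Variables (V P : finType) (own : P -> V) (inp : pred P) (E : rel P) (S : V) (r : nat).
Hypothesis wfE : wf_edges own inp E.

Definition cutmx (F : fieldType) (Om : {set V}) : 'M[F]_#|P| :=
  \matrix_(i < #|P|, j < #|P|)
    ([&& own (enum_val i) \in Om, ~~ inp (enum_val i),
         own (enum_val j) \notin Om, inp (enum_val j)
       & E (enum_val i) (enum_val j)] : nat)%:R.

Lemma mxrank_GOm p (F : finFieldType) (Om : {set V}) : p \in [pchar F] ->
  \rank (GOm p own inp E Om) = \rank (cutmx F Om).
Proof.
move=> Fp; rewrite -(mxrank_map (in_alg (pPrimeCharType Fp))); congr (\rank _).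
by apply/matrixP=> i j; rewrite !mxE rmorph_nat.
Qed.

Variable F : finFieldType.

Definition received_mx : 'M[F]_#|P| := \matrix_(i, j) (E (enum_val j) (enum_val i))%:R.

(* Unknowns: the symbols Y on all ports, then the r source symbols.  Equations:
   one per port, then r outputs, the k-th one read at the supernode g k; a
   symbol that nobody requests is read at S, which sees the source directly.
   The coding coefficients occupy exactly the blocks of equal colour. *)
Definition eq_owner (g : 'I_r -> V) (i : 'I_(#|P| + r)) : option V :=
  match split i with
  | inl e => if inp (enum_val e) then None else Some (own (enum_val e))
  | inr k => Some (g k)
  end.

Definition var_owner (j : 'I_(#|P| + r)) : option V :=
  match split j with
  | inl e => if inp (enum_val e) then Some (own (enum_val e)) else None
  | inr k => Some S
  end.

Definition fixed_mx : 'M[F]_(#|P| + r) := block_mx (1%:M - received_mx) 0 0 0.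

(** No port is both the head of one edge and the tail of another. *)
Lemma received_mx_nilpotent (A : pred 'I_#|P|) :
  received_mx *m diag_proj F A *m received_mx = 0.
Proof.
apply/matrixP=> i j; rewrite !mxE big1 // => k _; rewrite mul_mx_diag_projE !mxE.
case Eki: (E _ _); last by rewrite !mul0r.
case Ejk: (E _ _); last by rewrite mulr0.
by have /and3P[/negPf outk _ _] := wfE Eki; have /and3P[_] := wfE Ejk; rewrite outk.
Qed.

Lemma cut_rank_network (g : 'I_r -> V) (Om : {set V}) :
    (S \in Om -> #|[pred k | g k \notin Om]| <= \rank (cutmx F Om))%N ->
  (#|P| + r <= cut_rank (eq_owner g) var_owner setT Om fixed_mx)%N.
Proof.
move=> cutOm; rewrite /cut_rank /fixed_mx setTD !card_ord_add !diag_proj_add !mulmx_block.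
rewrite !(mul0mx, mulmx0, addr0) rank_diag_block_mx mxrank0 addn0.
have spl m n (i : 'I_m) : split (lshift n i) = inl i by exact: (unsplitK (inl i)).
have spr m n (i : 'I_n) : split (rshift m i) = inr i by exact: (unsplitK (inr i)).
set A := [pred i | _ (lshift r i)]; set G := [pred k | _ (rshift _ k)].
set B := [pred i | _ (lshift r i)]; set C := [pred k | _ (rshift _ k)].
set A' := [pred i | _ (lshift r i)]; set B' := [pred i | _ (lshift r i)].
(* The ports split into output ports inside [Om] (deleted rows, [A]), input ports outside [Om]
   (deleted columns, [B]), and the rest, [D], whose diagonal entry survives. *)
pose D : pred 'I_#|P| := [pred i | inp (enum_val i) == (own (enum_val i) \in Om)].
have AE i : A i = ~~ inp (enum_val i) && (own (enum_val i) \in Om).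
  by rewrite /A /= /coloured /eq_owner spl; case: ifP.
have BE i : B i = inp (enum_val i) && (own (enum_val i) \notin Om).
  by rewrite /B /= /coloured /var_owner spl; case: ifP; rewrite //= inE.
have GE k : G k = (g k \in Om) by rewrite /G /= /coloured /eq_owner spr.
have CE k : C k = (S \notin Om) by rewrite /C /= /coloured /var_owner spr /= inE.
have rkD : (#|D| + \rank (cutmx F Om) <=
    \rank (diag_proj F A' *m (1%:M - received_mx) *m diag_proj F B')%R)%N.
  (* An edge entry sits in the row of an input port and the column of an output port, so no deletion
     touches it. *)
  have -> : diag_proj F A' *m (1%:M - received_mx) *m diag_proj F B' =
            diag_proj F D - received_mx.
    apply/matrixP=> i j; rewrite mul_mx_diag_projE mul_diag_projE !mxE.
    have -> : A' i = ~~ A i by []. have -> : B' j = ~~ B j by [].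
    rewrite AE BE /=; case Eji: (E _ _).
      have /and3P[/negPf-> ini /negPf ow] := wfE Eji; rewrite ini /= mul1r mulr1.
      case: (i =P j) ow => [->|_ _]; first by rewrite eqxx.
      by rewrite mulr0n.
    rewrite !subr0; case: (i =P j) => [->|_]; rewrite ?mulr1n ?mulr0n ?mulr0 ?mul0r //.
    by rewrite mulr1 -natrM mulnb /D /=; case: (inp _) (own _ \in _) => [] [].
  have := @mxrank_idem_nilpotent F _ (diag_proj F D) received_mx.
  move=> /(_ (diag_proj_idem _ _)).
  have := received_mx_nilpotent predT.
  have -> : diag_proj F predT = 1%:M :> 'M_#|P| by apply/matrixP=> i j; rewrite !mxE.
  rewrite mulmx1 => -> /(_ erefl (received_mx_nilpotent _)).
  (* Off [D], the surviving edges run from outputs inside [Om] to inputs outside: the transpose of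
     the cut matrix. *)
  apply: leq_trans; rewrite leq_add ?mxrank_diag_proj // -mxrank_tr -diag_projC.
  rewrite eq_leq //; congr (\rank _); apply/matrixP=> i j.
  rewrite mul_mx_diag_projE mul_diag_projE !mxE /=.
  case Eij: (E _ _); last by rewrite !andbF mulr0 mul0r.
  have /and3P[/negPf outj ini _] := wfE Eij.
  rewrite mulr1 -natrM mulnb /D /= outj ini /= !andbT.
  by case: (_ \in Om) (_ \in Om) => [] [].
have ports : (#|A| + #|B| + #|D| = #|P|)%N.
  rewrite -[RHS]card_ord -[RHS]sum1_card -(sum1_card A) -(sum1_card B) -(sum1_card D).
  rewrite big_mkcond [X in (_ + X + _)%N]big_mkcond.
  rewrite [X in (_ + X)%N = _]big_mkcond -!big_split; apply: eq_bigr => i _.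
  rewrite (_ : (i \in A) = A i) // (_ : (i \in B) = B i) // AE BE inE /=.
  by case: (inp _) (own _ \in _) => [] [].
have srcs : (r <= #|G| + #|C| + \rank (cutmx F Om))%N.
  (* If [S] is in [Om], the cut rank pays for the outputs read outside. Otherwise all [r] source
     columns are among the deleted ones. *)
  have [SOm|SOm] := boolP (S \in Om).
    rewrite -[leqLHS]card_ord -(cardC G) addnAC (leq_trans _ (leq_addr _ _)) // leq_add2l.
    rewrite (leq_trans _ (cutOm SOm)) // subset_leq_card //.
    by apply/subsetP=> k; rewrite !inE -GE.
  rewrite addnAC (leq_trans _ (leq_addl _ _)) // -[leqLHS]card_ord subset_leq_card //.
  by apply/subsetP=> k _; rewrite (_ : (k \in C) = C k) // CE.
apply: leq_trans (leq_add (eq_leq (esym ports)) srcs) _.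
by rewrite addn.[AC (3*3) (1*4*(2*5)*(3*6))] leq_add2l.
Qed.

End Network.

(** * Port equations, transfer matrix and necessity of the cuts *)

Section LinearCode.
Local Open Scope ring_scope.
Variables (V P : finType) (own : P -> V) (inp : pred P) (E : rel P) (S : V) (r : nat).
Hypotheses (wfE : wf_edges own inp E) (acE : acyclic_net own E).
Variable F : finFieldType.

Lemma acyclic_ports_ind (Q : V -> Prop) :
  (forall v, (forall e e', E e e' -> own e' = v -> Q (own e)) -> Q v) -> forall v, Q v.
Proof.
(* Induction on the number of ancestors, [v] included: a predecessor of [v] has all its ancestors
   among those of [v], but not [v] itself. *)
move=> step v; pose anc u := [set w | connect (sedge own E) w u].
elim: {v}#|anc v| {-2}v (leqnn #|anc v|) => [|d IHd] v.
  by rewrite leqn0 cards_eq0 => /eqP/setP/(_ v); rewrite !inE connect0.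
move=> vd; apply: step => e e' Eee' ev; apply: IHd; rewrite -ltnS (leq_trans _ vd) //.
have ee' : sedge own E (own e) v.
  by apply/existsP; exists e; apply/existsP; exists e'; rewrite Eee' ev !eqxx.
apply: proper_card; apply/properP; split.
  by apply/subsetP=> u; rewrite !inE => /connect_trans; apply; apply: connect1.
by exists v; rewrite inE ?connect0 // acE.
Qed.

(** These equations refer to ports outside [Om] only and have no source term, so zero propagates
    along the acyclic order: at each supernode first to the inputs, then to the outputs. *)
Lemma silent_outside (Om : {set V}) (beta : P -> P -> F) (Y : P -> F) :
    (forall e, own e \notin Om -> Y e =
      if inp e then \sum_(e0 | E e0 e && (own e0 \notin Om)) Y e0
      else \sum_(e' | inp e' && (own e' == own e)) beta e' e * Y e') ->
  forall e, own e \notin Om -> Y e = 0.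
Proof.
move=> Yeq e; move: {2}(own e) (erefl (own e)) => v; elim/acyclic_ports_ind: v e => v IHv.
have in0 e : inp e -> own e = v -> own e \notin Om -> Y e = 0.
  move=> ine ev vOm; rewrite Yeq // ine big1 // => e0 /andP[E0 e0Om].
  exact: IHv E0 ev _ erefl e0Om.
move=> e ev vOm; have [ine|oute] := boolP (inp e); first exact: in0.
rewrite Yeq // (negPf oute) big1 // => e' /andP[ine' /eqP e'e].
by rewrite in0 ?mulr0 // e'e.
Qed.

Definition beta_mx (beta : P -> P -> F) : 'M[F]_#|P| := \matrix_(i, j)
  ([&& ~~ inp (enum_val i), inp (enum_val j) & own (enum_val j) == own (enum_val i)]%:R
   * beta (enum_val j) (enum_val i)).

Definition alpha_mx (alpha : 'I_r -> P -> F) : 'M[F]_(#|P|, r) := \matrix_(i, k)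
  ((~~ inp (enum_val i) && (own (enum_val i) == S))%:R * alpha k (enum_val i)).

Definition system_mx beta : 'M[F]_#|P| := 1%:M - received_mx E F - beta_mx beta.

Definition port_col (Y : P -> F) : 'cV[F]_#|P| := \col_i Y (enum_val i).

Lemma sum_enum_val (f : P -> F) : \sum_(i < #|P|) f (enum_val i) = \sum_e f e.
Proof. by rewrite [RHS](reindex _ (onW_bij _ (@enum_val_bij P))). Qed.

Lemma system_mxE beta Y i : (system_mx beta *m port_col Y) i 0 =
  Y (enum_val i) - (if inp (enum_val i) then \sum_(e0 | E e0 (enum_val i)) Y e0
    else \sum_(e' | inp e' && (own e' == own (enum_val i))) beta e' (enum_val i) * Y e').
Proof.
rewrite !mulmxBl mul1mx !mxE -addrA -opprD; congr (_ - _).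
under eq_bigr => j _ do rewrite !mxE.
under [X in _ + X]eq_bigr => j _ do rewrite !mxE.
rewrite (sum_enum_val (fun e0 => (E e0 (enum_val i))%:R * Y e0)).
rewrite (sum_enum_val (fun e' => [&& ~~ inp (enum_val i), inp e' & own e' == own (enum_val i)]%:R
   * beta e' (enum_val i) * Y e')).
have [ini|outi] := ifP.
  rewrite [X in _ + X]big1 ?addr0 => [|e _]; last by rewrite !mul0r.
  by rewrite [RHS]big_mkcond; apply: eq_bigr => e _; case: (E _ _); rewrite ?mul1r ?mul0r.
rewrite big1 ?add0r => [|e _].
  rewrite [RHS]big_mkcond; apply: eq_bigr => e _ /=.
  by case: (_ && _); rewrite ?mul1r ?mul0r.
by case Ee: (E _ _); rewrite ?mul0r //; have /and3P[_] := wfE Ee; rewrite outi.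
Qed.

Lemma alpha_mxE alpha (x : 'I_r -> F) i : (alpha_mx alpha *m (\col_k x k)) i 0 =
  if ~~ inp (enum_val i) && (own (enum_val i) == S)
  then \sum_(k < r) alpha k (enum_val i) * x k else 0.
Proof.
rewrite !mxE; under eq_bigr => k _ do rewrite !mxE -mulrA.
by rewrite -mulr_sumr; case: ifP => _; rewrite ?mul1r ?mul0r.
Qed.

Lemma consistent_system alpha beta x Y :
  consistent own inp E S alpha beta x Y <->
  system_mx beta *m port_col Y = alpha_mx alpha *m (\col_k x k).
Proof.
split=> [Yx|/colP Yx e].
  apply/colP=> i; rewrite system_mxE alpha_mxE [Y _]Yx.
  case: (inp _) => /=; first by rewrite subrr.
  by rewrite addrC addKr.
have := Yx (enum_rank e); rewrite system_mxE alpha_mxE enum_rankK.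
move/(canRL (subrK _)) ->; case: (inp e) => /=; first by rewrite add0r.
by rewrite addrC.
Qed.

Lemma system_unit beta : system_mx beta \in unitmx.
Proof.
rewrite -unitmx_tr -row_free_unit; apply: inj_row_free => v /(congr1 trmx).
rewrite trmx_mul trmxK trmx0 => sys0; pose Y e := v 0 (enum_rank e).
have vY : v^T = port_col Y by apply/colP=> i; rewrite !mxE /Y enum_valK.
suff Y0 e : Y e = 0 by apply/rowP=> i; have := Y0 (enum_val i); rewrite /Y enum_valK mxE.
apply: (@silent_outside set0 beta) => [{}e _|]; last by rewrite inE.
move/colP/(_ (enum_rank e)): sys0; rewrite vY system_mxE enum_rankK mxE.
move/(canRL (subrK _)); rewrite add0r => ->; case: ifP => // _.
by apply: eq_bigl => e0; rewrite inE andbT.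
Qed.

Definition transfer_mx alpha beta : 'M[F]_(#|P|, r) :=
  invmx (system_mx beta) *m alpha_mx alpha.

Lemma consistent_transfer alpha beta x Y :
  consistent own inp E S alpha beta x Y <->
  port_col Y = transfer_mx alpha beta *m (\col_k x k).
Proof.
rewrite /transfer_mx -mulmxA; split=> [/consistent_system <-|YM].
  by rewrite mulKmx ?system_unit.
by apply/consistent_system; rewrite YM mulKVmx ?system_unit.
Qed.

Lemma solvable_cut N (T : 'I_N -> V) dem (Om : {set V}) (K : {set 'I_r}) :
    @solvable_over F V P own inp E S r N T dem -> S \in Om ->
    (forall k, k \in K -> exists2 i, T i \notin Om & k \in dem i) ->
  (#|K| <= \rank (cutmx own inp E F Om))%N.
Proof.
case=> alpha [beta [eps solved]] SOm demK.
pose M := transfer_mx alpha beta; pose PK := diag_proj F (mem K).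
(* Let [x] be [v] restricted to [K]. If its symbols cancel across the cut, all ports outside [Om]
   are silent, so the destinations there output 0 and [x] vanishes on [K]. Comparing kernel
   dimensions then bounds [#|K|]. *)
have kerK : (kermx (PK *m (M^T *m cutmx own inp E F Om)) <= kermx PK)%MS.
  apply/rV_subP=> v; rewrite !sub_kermx => /eqP vH; apply/eqP.
  pose x k := (v *m PK) 0 k; pose Y e := (M *m \col_k x k) (enum_rank e) 0.
  have YM : port_col Y = M *m \col_k x k by apply/colP=> i; rewrite mxE /Y enum_valK.
  have Yx : consistent own inp E S alpha beta x Y by apply/consistent_transfer.
  have xE : (\col_k x k)^T = v *m PK by apply/rowP=> k; rewrite 2!mxE.
  have cut0 e : inp e -> own e \notin Om -> \sum_(e0 | E e0 e && (own e0 \in Om)) Y e0 = 0.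
    move=> ine eOm; have : (port_col Y)^T *m cutmx own inp E F Om = 0.
      by rewrite YM trmx_mul xE -!mulmxA.
    move/rowP/(_ (enum_rank e)); rewrite [RHS]mxE; apply: etrans.
    rewrite mxE big_mkcond -sum_enum_val; apply: eq_bigr => i _; rewrite !mxE enum_rankK ine eOm /= andbC.
    case Ee: (E _ _); last by rewrite !andbF mulr0.
    have /and3P[-> _ _] := wfE Ee; rewrite !andbT /=.
    by case: (_ \in _); rewrite ?mulr1 ?mulr0.
  have Y0 : forall e, own e \notin Om -> Y e = 0.
    apply: (@silent_outside Om beta) => e eOm; rewrite Yx; case: ifP => ine.
      rewrite (bigID (fun e0 => own e0 \in Om)) /= cut0 ?add0r //.
    by rewrite ifN ?addr0 //; apply: contraNneq eOm => ->.
  apply/rowP=> k; rewrite [RHS]mxE -/(x k); have [kK|kK] := boolP (k \in K).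
    have [i TiOm kd] := demK k kK; rewrite -(solved x Y Yx i k kd) /dest_out big1 //.
    by move=> e /andP[_ /eqP eT]; rewrite Y0 ?mulr0 // eT.
  by rewrite /x mul_mx_diag_projE /= (negPf kK) mulr0.
have leK : (\rank PK <= \rank (PK *m (M^T *m cutmx own inp E F Om)))%N.
  have := mxrankS kerK; rewrite !mxrank_ker leq_subCl subKn //; exact: rank_leq_row.
rewrite (leq_trans _ (leq_trans leK _)) //.
  by have := mxrank_diag_proj F (mem K); rewrite (eq_card (B := mem K)).
by rewrite mulmxA mxrankM_maxr.
Qed.

End LinearCode.

(** * Common coding coefficients for several families of outputs *)

Section Achievability.
Local Open Scope ring_scope.
Variables (V P : finType) (own : P -> V) (inp : pred P) (E : rel P) (S : V) (r : nat).
Hypotheses (wfE : wf_edges own inp E) (acE : acyclic_net own E).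
Variable F : finFieldType.
Notation n := #|P|.
Notation vown := (@var_owner V P own inp S r).
Notation eown := (@eq_owner V P own inp r).

Definition port_owner (i : 'I_n) : option V :=
  if inp (enum_val i) then None else Some (own (enum_val i)).

Lemma eq_ownerl (g : 'I_r -> V) i : eown g (lshift r i) = port_owner i.
Proof. by rewrite /eq_owner (unsplitK (inl i)). Qed.

Lemma eq_ownerr (g : 'I_r -> V) k : eown g (rshift n k) = Some (g k).
Proof. by rewrite /eq_owner (unsplitK (inr k)). Qed.

Lemma var_ownerl i : vown (lshift r i) =
  if inp (enum_val i) then Some (own (enum_val i)) else None.
Proof. by rewrite /var_owner (unsplitK (inl i)). Qed.

Lemma var_ownerr k : vown (rshift n k) = Some S.
Proof. by rewrite /var_owner (unsplitK (inr k)). Qed.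

(* Only the equations of the ports are shared by the families of outputs g j. *)
Definition readable (g : 'I_r -> V) (X : 'M[F]_(n, n + r)) :=
  exists2 Z : 'M_(r, n + r),
    block_supported (fun k => Some (g k)) vown setT Z &
    (n + r <= \rank (col_mx (usubmx (fixed_mx E r F) + X)%R Z))%N.

Lemma generic_readable g : generic (n + r) (readable g).
Proof.
(* The reading rows [Z] found at [t0] are kept fixed along the whole line; only the port equations
   move. *)
move=> b c t0 [Z SZ]; set Q := usubmx _ => rkZ.
have line t : col_mx (Q + (b + t *: c)) Z = col_mx (Q + b) Z + t *: col_mx c 0.
  by rewrite scale_col_mx add_col_mx scaler0 addr0 addrA.
move: rkZ; rewrite line => /generic_mxrank[B Bk BC].
by exists B => // t /BC; rewrite -line => rk; exists Z.
Qed.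

Lemma readable_exists (g : 'I_r -> V) :
    (2 * (n + r) < #|F|)%N ->
    (forall Om : {set V}, S \in Om -> #|[pred k | g k \notin Om]| <= \rank (cutmx own inp E F Om))%N ->
  exists2 X, block_supported port_owner vown setT X & readable g X.
Proof.
move=> bigF cutg; have [|X SX rkX] := @block_rank F V _ _ (eown g)
    vown setT (fixed_mx E r F) (n + r) bigF.
  by move=> Om _; apply: cut_rank_network (cutg Om).
exists (usubmx X) => [i j|].
  by rewrite mxE => /SX; rewrite /coloured eq_ownerl.
exists (dsubmx X) => [k j|]; first by rewrite mxE => /SX; rewrite /coloured eq_ownerr.
have fix0 : dsubmx (fixed_mx E r F) = 0 by rewrite /fixed_mx block_mxEv col_mxKd row_mx0.
have -> : dsubmx X = dsubmx (fixed_mx E r F) + dsubmx X by rewrite fix0 add0r.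
by rewrite -!linearD /= vsubmxK.
Qed.

Lemma readable_family (J : finType) (g : J -> 'I_r -> V) :
    (2 * (n + r) < #|F|)%N -> (#|J| * (n + r) < #|F|)%N ->
    (forall j (Om : {set V}), S \in Om ->
       #|[pred k | g j k \notin Om]| <= \rank (cutmx own inp E F Om))%N ->
  exists2 X, block_supported port_owner vown setT X &
             forall j, readable (g j) X.
Proof.
move=> bigF bigJ cutg; apply: (@generic_exists F _ J (n + r)) => //.
- exact: block_supported0.
- by move=> b c t; apply: block_supported_line.
- by move=> j; apply: generic_readable.
- by move=> j; apply: readable_exists bigF (cutg j).
Qed.

Lemma transfer_unit alpha beta (Zl : 'M[F]_(r, n)) (Zr : 'M_r) :
    (n + r <= \rank (col_mx (row_mx (system_mx own inp E beta)
                                    (- alpha_mx own inp S alpha)) (row_mx Zl Zr)))%N ->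
  Zl *m transfer_mx own inp E S alpha beta + Zr \in unitmx.
Proof.
set B := col_mx _ _ => rkB; set N := transfer_mx _ _ _ _ _ _.
have uB : B \in unitmx by rewrite -row_free_unit /row_free eqn_leq rank_leq_row.
(* By this identity, the lower right block of the inverse of [B] is an inverse of [Zl *m N + Zr]. *)
have BN : B *m col_mx N 1%:M = col_mx 0 (Zl *m N + Zr).
  rewrite mul_col_mx !mul_row_col !mulmx1 /N /transfer_mx mulKVmx ?system_unit //.
  by rewrite subrr.
have /(congr1 (fun M => dsubmx (invmx B *m M))) := BN.
rewrite mulKmx // col_mxKd -[invmx B]submxK mul_block_col col_mxKd mulmx0 add0r.
by move=> /esym /mulmx1_unit[].
Qed.

Lemma code_exists (J : finType) (g : J -> 'I_r -> V) :
    (2 * (n + r) < #|F|)%N -> (#|J| * (n + r) < #|F|)%N ->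
    (forall j (Om : {set V}), S \in Om ->
       #|[pred k | g j k \notin Om]| <= \rank (cutmx own inp E F Om))%N ->
  exists (alpha : 'I_r -> P -> F) beta, forall j, exists (Z : 'M[F]_(r, n)) (G : 'M[F]_r),
    [/\ forall k e, Z k e != 0 -> inp (enum_val e) && (own (enum_val e) == g j k),
        forall k l, G k l != 0 -> g j k = S
      & Z *m transfer_mx own inp E S alpha beta + G \in unitmx].
Proof.
move=> bigF bigJ cutg; have [X SX gX] := readable_family bigF bigJ cutg.
(* The signs match the system [1 - received - beta] with source block [- alpha]. *)
pose alpha (k : 'I_r) e := - rsubmx X (enum_rank e) k.
pose beta e' e := - lsubmx X (enum_rank e) (enum_rank e').
exists alpha, beta => j; have [Z SZ rkZ] := gX j.
exists (lsubmx Z), (rsubmx Z); split=> [k e|k l|].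
- rewrite mxE => /SZ[_]; rewrite var_ownerl; case: ifP => // _ [->]; exact: eqxx.
- by rewrite mxE => /SZ[_]; rewrite var_ownerr => -[].
apply: transfer_unit; rewrite hsubmxK; apply: leq_trans rkZ _.
rewrite eq_leq //; congr (\rank (col_mx _ _)).
rewrite -[X in _ + X]hsubmxK /fixed_mx block_mxEv col_mxKu add_row_mx add0r /system_mx.
congr (row_mx (_ + _) _); apply/matrixP=> i k; rewrite !mxE /alpha /beta !enum_valK !mxE.
  have [->|/SX[]] := eqVneq (X i (lshift r k)) 0; first by rewrite oppr0 mulr0 oppr0.
  rewrite var_ownerl /coloured /port_owner; case: (inp _); case: (inp _) => // _ [->].
  by rewrite eqxx mul1r opprK.
have [->|/SX[]] := eqVneq (X i (rshift n k)) 0; first by rewrite oppr0 mulr0 oppr0.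
by rewrite var_ownerr /coloured /port_owner; case: (inp _) => // _ [->]; rewrite eqxx mul1r opprK.
Qed.

End Achievability.

(** * Minimum cuts and sizes of disjoint unions *)

Lemma leq_bigmin_seq (I : Type) (s : seq I) (Q : pred I) (f : I -> nat) d k :
  (k <= \big[minn/d]_(i <- s | Q i) f i) = (k <= d) && all (fun i => Q i ==> (k <= f i)) s.
Proof.
elim: s => [|i s IHs]; first by rewrite big_nil andbT.
by rewrite big_cons /=; case: (Q i); rewrite ?leq_min IHs // andbCA.
Qed.

Lemma leq_mincut p (V P : finType) (own : P -> V) (inp : pred P) (E : rel P) (S : V)
    (T' : {set V}) k : S \notin T' ->
  k <= mincut p own inp E S T' <->
  (forall Om : {set V}, S \in Om -> [disjoint T' & Om] -> k <= \rank (GOm p own inp E Om)).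
Proof.
move=> ST'; rewrite /mincut leq_bigmin_seq; split=> [/andP[_ /allP kOm] Om SOm T'Om|kOm].
  by have := kOm Om (mem_index_enum _); rewrite SOm T'Om.
(* The default value [#|P|] of the minimum is harmless: the admissible cut [[set S]] has rank at
   most [#|P|]. *)
apply/andP; split; last by apply/allP=> Om _; apply/implyP=> /andP[]; apply: kOm.
apply: leq_trans (kOm [set S] (set11 S) _) (rank_leq_row _).
by rewrite disjoint_sym disjoints1.
Qed.

Lemma sum_card_disjoint (I X : finType) (A : {set I}) (D : I -> {set X}) :
    (forall i j, i \in A -> j \in A -> i != j -> [disjoint D i & D j]) ->
  \sum_(i in A) #|D i| = #|\bigcup_(i in A) D i|.
Proof.
move=> disD; pose D' i := if i \in A then D i else set0.
have disD' i j : i != j -> [disjoint D' i & D' j].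
  move=> ij; rewrite /D'; case: ifP => iA; last by rewrite disjoints_subset sub0set.
  by case: ifP => jA; [exact: disD | rewrite disjoint_sym disjoints_subset sub0set].
rewrite [in RHS]big_mkcond -sum1_card (partition_disjoint_bigcup _ _ disD') big_mkcond.
by apply: eq_bigr => i _; rewrite sum1_card /D'; case: ifP => // _; rewrite cards0.
Qed.

(** * Precoding and decoding *)

Section Precoding.
Local Open Scope ring_scope.
Variables (V P : finType) (own : P -> V) (inp : pred P) (E : rel P) (S : V) (r : nat).
Hypotheses (wfE : wf_edges own inp E) (acE : acyclic_net own E).
Variable F : finFieldType.

Lemma dest_outE N (T : 'I_N -> V) (W : 'I_N -> 'M[F]_(r, #|P|)) Y i k :
    (forall e, W i k e != 0 -> inp (enum_val e) && (own (enum_val e) == T i)) ->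
  dest_out own inp T (fun i k e => W i k (enum_rank e)) Y i k = (W i *m port_col Y) k 0.
Proof.
move=> suppW; rewrite mxE /dest_out big_mkcond -sum_enum_val; apply: eq_bigr => e _.
rewrite mxE enum_valK; have [->|/suppW -> //] := eqVneq (W i k e) 0.
by rewrite mul0r if_same.
Qed.

Lemma transfer_precode alpha beta (C : 'M[F]_r) :
  transfer_mx own inp E S (fun k e => \sum_l alpha l e * C l k) beta =
  transfer_mx own inp E S alpha beta *m C.
Proof.
rewrite /transfer_mx -mulmxA; congr (_ *m _); apply/matrixP=> i k; rewrite !mxE mulr_sumr.
by apply: eq_bigr => l _; rewrite mxE mulrA.
Qed.

(* The code is precoded by the inverse of the transfer matrix to the outputs
   that None stands for; the remaining families then decode by inversion. *)
Lemma solvable_of_families N (T : 'I_N -> V) (dem : 'I_N -> {set 'I_r})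
    (multi : pred 'I_N) (g : 'I_r -> V) :
    (forall i, T i != S) ->
    (2 * (#|P| + r) < #|F|)%N -> (N.+1 * (#|P| + r) < #|F|)%N ->
    (forall i k, ~~ multi i -> k \in dem i -> g k = T i) ->
    (forall Om : {set V}, S \in Om ->
       #|[pred k | g k \notin Om]| <= \rank (cutmx own inp E F Om))%N ->
    (forall i (Om : {set V}), multi i -> S \in Om -> T i \notin Om ->
       r <= \rank (cutmx own inp E F Om))%N ->
  @solvable_over F V P own inp E S r N T dem.
Proof.
move=> TS bigF bigN gT cutg cutm.
(* [None] is the disjoint multicast, [Some i] a full destination. For any other [i] all outputs are
   read at [S], where the cut condition is void. *)
pose gs (j : option 'I_N) k := if j is Some i then if multi i then T i else S else g k.
have [||j Om SOm|alpha [beta codeZ]] := @code_exists V P own inp E S r wfE acE F _ gs.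
- exact: bigF.
- by rewrite card_option card_ord.
- case: j => [i|]; last exact: cutg.
  rewrite /gs; case: ifP => mi; last by rewrite eq_card0 // => k; rewrite !inE SOm.
  have [TOm|TOm] := boolP (T i \in Om); first by rewrite eq_card0 // => k; rewrite !inE TOm.
  by rewrite (leq_trans (max_card _)) // card_ord (cutm i).
have [Z0 [G0 [Z0s G0s uC]]] := codeZ None; set M := transfer_mx _ _ _ _ _ _ in uC.
pose C := Z0 *m M + G0; rewrite -/C in uC.
have W i : exists W : 'M[F]_(r, #|P|), forall k, k \in dem i ->
    (forall e, W k e != 0 -> inp (enum_val e) && (own (enum_val e) == T i)) /\
    row k (W *m (M *m invmx C)) = row k 1%:M.
  have [mi|mi] := boolP (multi i); last first.
    (* As [g k = T i] differs from [S], row [k] of [C] comes from [Z0 *m M] alone, and precoding by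
       [invmx C] makes it a unit row. *)
    exists Z0 => k kd; have gk := gT i k mi kd; split=> [e /Z0s|]; first by rewrite /= gk.
    have G0k : row k G0 = 0.
      apply/rowP=> l; rewrite !mxE; apply/eqP; apply: contraNT (TS i) => /G0s <-.
      by rewrite /= gk.
    by rewrite -(mulmxV uC) mulmxA !row_mul [row k C]linearD /= G0k addr0 row_mul.
  have [Z [G [Zs Gs uZ]]] := codeZ (Some i); rewrite /= mi in Zs Gs.
  have G0k : G = 0.
    apply/matrixP=> k l; rewrite mxE; apply/eqP; apply: contraNT (TS i) => /Gs ->.
    exact: eqxx.
  move: uZ; rewrite G0k addr0 -/M => uZ.
  have uZC : Z *m M *m invmx C \in unitmx by rewrite unitmx_mul uZ unitmx_inv.
  exists (invmx (Z *m M *m invmx C) *m Z) => k _; split=> [e|]; last first.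
    by rewrite -[_ *m Z *m _]mulmxA (mulmxA Z) mulVmx.
  apply: contraNT => nTe; rewrite mxE big1 // => l _.
  suff -> : Z l e = 0 by rewrite mulr0.
  by apply/eqP; apply: contraNT nTe => /Zs.
have [Wf WfE] := fin_all_exists W.
exists (fun k e => \sum_l alpha l e * invmx C l k), beta, (fun i k e => Wf i k (enum_rank e)).
move=> x Y /(consistent_transfer S wfE acE); rewrite transfer_precode -/M => YM i k kd.
have [Ws Wk] := WfE i k kd; rewrite (dest_outE _ Ws) YM mulmxA.
have -> (A : 'M[F]_r) (y : 'cV_r) : (A *m y) k 0 = (row k A *m y) 0 0.
  by rewrite -row_mul [RHS]mxE.
by rewrite Wk -row_mul mul1mx !mxE.
Qed.

End Precoding.

(** * Equivalence of solvability and the cut conditions *)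

Theorem theorem7 (p : nat) (V P : finType) (own : P -> V) (inp : pred P)
    (E : rel P) (S : V) (r N K : nat) (T : 'I_N -> V)
    (D : 'I_N -> {set 'I_r}) :
  prime p -> wf_edges own inp E -> acyclic_net own E ->
  injective T -> (forall i, T i != S) -> K <= N ->
  (forall i j : 'I_N, i < K -> j < K -> i != j -> [disjoint D i & D j]) ->
  let dem := fun i : 'I_N => if i < K then D i else [set: 'I_r] in
  (exists F : finFieldType, (p \in [pchar F])%R /\
      @solvable_over F V P own inp E S r N T dem) <->
  ((forall I : {set 'I_N}, (forall i, i \in I -> i < K) ->
      \sum_(i in I) #|D i| <= mincut p own inp E S (T @: I)) /\
   (forall j : 'I_N, K <= j -> r <= mincut p own inp E S [set T j])).
Proof.
move=> p_pr wfE acE _ TS _ disD dem.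
have ST (I : {set 'I_N}) : S \notin T @: I.
  by apply/imsetP=> -[i _ Si]; have := TS i; rewrite -Si eqxx.
have ST1 j : S \notin [set T j] by rewrite inE eq_sym TS.
split=> [[F [Fp solv]]|[cutD cutM]].
  split=> [I IK|j Kj]; apply/leq_mincut=> // Om SOm TOm; rewrite (mxrank_GOm _ _ _ _ Fp).
    rewrite sum_card_disjoint => [|i j iI jI]; last by apply: disD; apply: IK.
    apply: (solvable_cut wfE acE solv SOm) => k /bigcupP[i iI ki].
    exists i; last by rewrite /dem IK.
    by rewrite (disjointFr TOm) // imset_f.
  rewrite -[leqLHS]card_ord -[leqLHS]cardsT.
  apply: (solvable_cut wfE acE solv SOm) => k _; exists j; last by rewrite /dem ltnNge Kj.
  by rewrite (disjointFr TOm) // set11.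
(* The field is taken with [p ^ m] elements; [p ^ m > m] exceeds both size bounds at once. *)
pose m := (2 * (#|P| + r) + N.+1 * (#|P| + r)).+1.
have [F Fp cardF] := pPrimePowerField p_pr (ltn0Sn _ : 0 < m).
have bigF : m <= #|F| by rewrite cardF ltnW // ltn_expl // prime_gt1.
exists F; split=> //.
(* Symbol [k] is read at the destination of the disjoint multicast that demands it, unique by
   disjointness, or at [S] if there is none. *)
pose g k := if [pick i : 'I_N | (i < K) && (k \in D i)] is Some i then T i else S.
apply: (@solvable_of_families _ _ _ _ _ _ _ wfE acE _ _ _ _ (fun i => K <= i) g) => //.
- by apply: leq_trans bigF; rewrite ltnS leq_addr.
- by apply: leq_trans bigF; rewrite ltnS leq_addl.
- move=> i k; rewrite -ltnNge /dem => iK; rewrite iK => kDi.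
  rewrite /g; case: pickP => [j /andP[jK kDj]|/(_ i)]; last by rewrite iK kDi.
  by have [->//|/(disD _ _ jK iK)/disjointFr/(_ kDj)] := eqVneq j i; rewrite kDi.
(* The symbols read outside [Om] are demanded by the destinations in [I], so the cut condition for
   [T @: I] bounds their number. *)
- move=> Om SOm; pose I := [set i : 'I_N | (i < K) && (T i \notin Om)].
  rewrite -(mxrank_GOm _ _ _ _ Fp).
  apply: leq_trans (_ : _ <= \sum_(i in I) #|D i|) _.
    rewrite sum_card_disjoint => [|i j]; last first.
      by rewrite !inE => /andP[iK _] /andP[jK _]; apply: disD.
    apply/subset_leq_card/subsetP=> k; rewrite inE /g.
    case: pickP => [i /andP[iK kDi] TOm|_]; last by rewrite SOm.
    by apply/bigcupP; exists i; rewrite // inE iK.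
  have cutI : \sum_(i in I) #|D i| <= mincut p own inp E S (T @: I).
    by apply: cutD => i; rewrite inE => /andP[].
  apply: (leq_mincut _ _ _ _ _ (ST I)).1 cutI _ SOm _.
  rewrite disjoint_subset; apply/subsetP=> _ /imsetP[i + ->].
  by rewrite !inE => /andP[].
- move=> i Om Ki SOm TOm; rewrite -(mxrank_GOm _ _ _ _ Fp).
  apply: (leq_mincut _ _ _ _ _ (ST1 i)).1 (cutM i Ki) _ SOm _.
  by rewrite disjoints1.
Qed.
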